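(* For every positive integer $n$, $$\sum_{k=0}^{n}\binom{n}{k}\left(\sqrt{y^2+4t}\right)^{n-k}\left(2^kL_k(y,t)+2y^k\right)E_{n-k}(x)=2\left(y+\sqrt{y^2+4t}\,x\right)^{n}+2\left(y+(x-1)\sqrt{y^2+4t}\right)^{n}.$$
   Context: Here $x,y,t$ are commuting variables (indeterminates) and $\sqrt{y^2+4t}$ denotes a fixed square root of $y^2+4t$ (in an extension field of the field of rational functions in $x,y,t$). The bivariate Lucas polynomials are defined by $L_0(y,t)=2$, $L_1(y,t)=y$, $L_n(y,t)=yL_{n-1}(y,t)+tL_{n-2}(y,t)$ for $n\ge 2$. The Euler polynomials $E_n(x)$ are defined by $\sum_{n\ge 0}E_n(x)\frac{z^n}{n!}=\frac{2e^{xz}}{e^z+1}$. *)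

(* Defs.v *)
From HB Require Import structures.
From mathcomp Require Import all_boot all_order all_algebra.
From mathcomp Require Import fraction mpoly.

Set Implicit Arguments.
Unset Strict Implicit.
Unset Printing Implicit Defensive.

Import GRing.Theory.
Local Open Scope ring_scope.

Fixpoint lucas (R : comNzRingType) (y t : R) (n : nat) : R :=
  match n with
  | 0 => 2
  | 1 => y
  | (m.+1 as k).+1 => y * lucas y t k + t * lucas y t m
  end.

(* A formal power series in z is the sequence of its coefficients. *)
Definition fps (R : comUnitRingType) := nat -> R.

Definition fps_const (R : comUnitRingType) (c : R) : fps R :=
  fun n => if n == 0%N then c else 0.

Definition fps_add (R : comUnitRingType) (a b : fps R) : fps R :=
  fun n => a n + b n.

Definition fps_mul (R : comUnitRingType) (a b : fps R) : fps R :=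
  fun n => \sum_(i < n.+1) a i * b (n - i)%N.

Fixpoint fps_inv_seq (R : comUnitRingType) (a : fps R) (n : nat) : seq R :=
  if n is m.+1 then
    let s := fps_inv_seq a m in
    rcons s (- (a 0%N)^-1 * \sum_(i < m.+1) s`_i * a (m.+1 - i)%N)
  else [:: (a 0%N)^-1].

(* Multiplicative inverse, meaningful when the constant term is a unit
   (see fps_mulVr). *)
Definition fps_inv (R : comUnitRingType) (a : fps R) : fps R :=
  fun n => (fps_inv_seq a n)`_n.

(* e^{cz} *)
Definition fps_exp (R : comUnitRingType) (c : R) : fps R :=
  fun n => c ^+ n / n`!%:R.

Lemma size_fps_inv_seq (R : comUnitRingType) (a : fps R) n :
  size (fps_inv_seq a n) = n.+1.
Proof. by elim: n => //= n IHn; rewrite size_rcons IHn. Qed.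

Lemma nth_fps_inv_seq (R : comUnitRingType) (a : fps R) n i :
  (i <= n)%N -> (fps_inv_seq a n)`_i = fps_inv a i.
Proof.
elim: n => [|n IHn]; first by rewrite leqn0 => /eqP->.
rewrite leq_eqVlt => /orP[/eqP-> //|lt_in].
by rewrite /= nth_rcons size_fps_inv_seq lt_in IHn.
Qed.

Lemma fps_mulVr (R : comUnitRingType) (a : fps R) :
  a 0%N \is a GRing.unit -> fps_mul (fps_inv a) a =1 fps_const 1.
Proof.
move=> Ua [|n]; rewrite /fps_mul /fps_const.
  by rewrite big_ord_recl big_ord0 addr0 /fps_inv /= mulVr.
rewrite big_ord_recr /= subnn.
have -> : fps_inv a n.+1 =
    - (a 0%N)^-1 * \sum_(i < n.+1) fps_inv a i * a (n.+1 - i)%N.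
  rewrite {1}/fps_inv /= nth_rcons size_fps_inv_seq ltnn eqxx.
  congr (_ * _); apply: eq_bigr => i _.
  by rewrite nth_fps_inv_seq // -ltnS.
by rewrite mulrAC mulNr mulVr // mulN1r subrr.
Qed.

Lemma fps_mul_coef (R : comUnitRingType) (a b : fps R) m n : (m <= n)%N ->
  fps_mul a b m = ((\poly_(i < n.+1) a i) * (\poly_(i < n.+1) b i))`_m.
Proof.
move=> le_mn; rewrite coefM; apply: eq_bigr => i _; rewrite !coef_poly.
rewrite (leq_ltn_trans (leq_subr _ _)) ?ltnS //.
by rewrite (leq_trans _ le_mn) // -ltnS.
Qed.

Lemma fps_mulA (R : comUnitRingType) (a b c : fps R) :
  fps_mul a (fps_mul b c) =1 fps_mul (fps_mul a b) c.
Proof.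
move=> n.
pose P (f : fps R) := \poly_(i < n.+1) f i.
transitivity ((P a * (P b * P c))`_n).
  rewrite coefM; apply: eq_bigr => i _; rewrite coef_poly ltn_ord.
  by rewrite (@fps_mul_coef _ _ _ _ n) ?leq_subr.
rewrite mulrA coefM; apply: eq_bigr => i _.
rewrite coef_poly (leq_ltn_trans (leq_subr _ _)) //.
by rewrite (@fps_mul_coef _ _ _ _ n) // -ltnS.
Qed.

Lemma fps_mulr1 (R : comUnitRingType) (a : fps R) :
  fps_mul a (fps_const 1) =1 a.
Proof.
move=> n; rewrite /fps_mul big_ord_recr /= subnn mulr1 big1 ?add0r // => i _.
by rewrite /fps_const subn_eq0 leqNgt ltn_ord mulr0.
Qed.

(* E_n = n! [z^n] 2 e^{Xz} / (e^z + 1).  This is the usual Euler polynomial when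
   F has characteristic 0 (the factorials and 2 must be invertible). *)
Definition euler_egf (F : fieldType) : fps {poly F} :=
  fps_mul (fps_mul (fps_const 2) (fps_exp 'X))
          (fps_inv (fps_add (fps_exp 1) (fps_const 1))).

Definition euler_poly (F : fieldType) (n : nat) : {poly F} :=
  n`!%:R * euler_egf F n.

(* The defining identity (\sum_n E_n z^n / n!) (e^z + 1) = 2 e^{Xz}. *)
Lemma euler_polyP (F : fieldType) : [pchar F] =i pred0 ->
  fps_mul (fun n => euler_poly F n / n`!%:R)
          (fps_add (fps_exp 1) (fps_const 1))
  =1 fps_mul (fps_const 2) (fps_exp 'X).
Proof.
move=> charF.
have Unat n : (0 < n)%N -> (n%:R : {poly F}) \is a GRing.unit.
  move=> n_gt0; rewrite -polyC_natr rmorph_unit // unitfE.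
  by rewrite ((pcharf0P F).1 charF) -lt0n.
move=> n; set b := fps_add _ _.
have Ub : b 0%N \is a GRing.unit.
  have -> : b 0%N = 2%:R by rewrite /b /fps_add /fps_exp /fps_const /= divr1.
  exact: Unat.
set a := fps_mul (fps_const 2) _.
transitivity (fps_mul (fps_mul a (fps_inv b)) b n).
  apply: eq_bigr => i _.
  by rewrite /euler_poly [X in X * _]mulrAC divrr ?mul1r ?Unat ?fact_gt0.
rewrite -(fps_mulA a) -(fps_mulr1 a n); apply: eq_bigr => i _.
by rewrite fps_mulVr.
Qed.

(* The i-th indeterminate, as an element of the field of rational functions. *)
Definition ratvar (F : fieldType) (i : 'I_3) : {fraction {mpoly F[3]}} :=
  tofrac ('X_i : {mpoly F[3]}).

(* Main.v *)
(* With s = sqrt (y^2 + 4 t), Binet's formula gives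
   2^k L_k + 2 y^k = ((y + s)^k + y^k) + (y^k + (y - s)^k), so the theorem is the
   sum of two instances, at y and at y - s, of
     \sum_k C(n, k) s^(n-k) ((y + s)^k + y^k) E_(n-k)(x) = 2 (y + s x)^n,
   which is the coefficient of z^n / n! in
     E(s z) (e^(s z) + 1) e^(y z) = 2 e^(s x z) e^(y z),
   where E(z) is the exponential generating function of the E_n(x). *)

Require Import Defs.
From HB Require Import structures.
From mathcomp Require Import all_boot all_order all_algebra.
From mathcomp Require Import fraction mpoly.
From mathcomp Require Import ring.

Set Implicit Arguments.
Unset Strict Implicit.
Unset Printing Implicit Defensive.

Import GRing.Theory.
Local Open Scope ring_scope.

(** Since [y + s] and [y - s] are the roots of [X^2 - 2 y X - 4 t], both sides satisfy
    [u_(k+2) = 2 y u_(k+1) + 4 t u_k]. The factor [2 ^+ k] clears the denominators of Binet's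
    formula, so any commutative ring will do. *)
Lemma lucas_binet (R : comNzRingType) (y t s : R) (k : nat) :
  s ^+ 2 = y ^+ 2 + 4 * t ->
  2 ^+ k * lucas y t k = (y + s) ^+ k + (y - s) ^+ k.
Proof.
move=> Hs.
suff [] : 2 ^+ k * lucas y t k = (y + s) ^+ k + (y - s) ^+ k /\
  2 ^+ k.+1 * lucas y t k.+1 = (y + s) ^+ k.+1 + (y - s) ^+ k.+1 by [].
elim: k => [|k [IH0 IH1]]; first by split; rewrite /=; ring.
split=> //.
have -> : 2 ^+ k.+2 * lucas y t k.+2 =
    2 * y * (2 ^+ k.+1 * lucas y t k.+1) + 4 * t * (2 ^+ k * lucas y t k).
  by rewrite -[lucas y t k.+2]/(y * lucas y t k.+1 + t * lucas y t k) !exprS; ring.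
have -> : 4 * t = s ^+ 2 - y ^+ 2 by rewrite Hs addrC addKr.
by rewrite IH0 IH1 !exprS; ring.
Qed.

Section Char0.
Variables (L : fieldType).
Hypothesis charL : [pchar L] =i pred0.

Lemma natr_fact_neq0 (n : nat) : n`!%:R != 0 :> L.
Proof. by rewrite ((pcharf0P L).1 charL) -lt0n fact_gt0. Qed.

Lemma fps_expD (a b : L) :
  fps_mul (fps_exp a) (fps_exp b) =1 fps_exp (a + b).
Proof.
move=> n; rewrite /fps_exp addrC exprDn mulr_suml.
apply: eq_bigr => i _; have le_in : (i <= n)%N by rewrite -ltnS.
rewrite -(bin_fact le_in) !natrM -mulr_natr.
have C0 : 'C(n, i)%:R != 0 :> L.
  by rewrite ((pcharf0P L).1 charL) -lt0n bin_gt0.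
by field; rewrite C0 !natr_fact_neq0.
Qed.

Lemma euler_poly_horner (x : L) :
  fps_mul (fun n => (euler_poly L n).[x] / n`!%:R)
          (fps_add (fps_exp 1) (fps_const 1))
  =1 fps_mul (fps_const 2) (fps_exp x).
Proof.
(* An inverse taken in [{poly L}] must be exhibited as a constant polynomial before it can be
   evaluated. *)
have invE n : (n`!%:R : {poly L})^-1 = (n`!%:R^-1)%:P.
  by rewrite -polyC_natr polyCV.
move=> n; have /(congr1 (fun p => p.[x])) := euler_polyP charL n.
rewrite /fps_mul !horner_sum => E.
transitivity (\sum_(i < n.+1) (euler_poly L i / i`!%:R *
   fps_add (fps_exp 1) (fps_const 1) (n - i)%N).[x]).
  apply: eq_bigr => i _; rewrite /fps_add /fps_exp /fps_const !invE.
  by case: eqP => _; rewrite !hornerE.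
rewrite E; apply: eq_bigr => i _; rewrite /fps_exp /fps_const invE.
by case: eqP => _; rewrite !hornerE.
Qed.

Lemma euler_poly_binomial (x y s : L) (n : nat) :
  \sum_(k < n.+1) 'C(n, k)%:R * s ^+ (n - k) * ((y + s) ^+ k + y ^+ k)
     * (euler_poly L (n - k)).[x]
  = 2 * (y + s * x) ^+ n.
Proof.
(* [A] is E(s z) at the point [x], and [B] is e^(s z) + 1. *)
pose A : fps L := fun m => s ^+ m * ((euler_poly L m).[x] / m`!%:R).
pose B := fps_add (fps_exp s) (fps_const 1).
(* This is the defining identity under z -> s z, which multiplies the coefficient of index [m] by
   [s ^+ m]. *)
have AB : fps_mul A B =1 fps_mul (fps_const 2) (fps_exp (s * x)).
  move=> m; transitivity (s ^+ m * fps_mul (fps_const 2) (fps_exp x) m).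
    rewrite -euler_poly_horner mulr_sumr; apply: eq_bigr => i _.
    have le_im : (i <= m)%N by rewrite -ltnS.
    have -> : s ^+ m = s ^+ i * s ^+ (m - i) by rewrite -exprD subnKC.
    rewrite /A /B /fps_add /fps_exp /fps_const expr1n.
    (* The summand 1 of [B] contributes only at [m - i = 0], where its scaling factor is
       [s ^+ 0 = 1]. *)
    by case: eqP => [->|_]; rewrite ?expr0; ring.
  rewrite mulr_sumr; apply: eq_bigr => i _; rewrite /fps_const /fps_exp.
  case: eqP => [->|_]; last by rewrite !mul0r mulr0.
  by rewrite subn0 exprMn; ring.
have BC : fps_mul B (fps_exp y) =1 fps_add (fps_exp (y + s)) (fps_exp y).
  move=> m; rewrite /fps_add [y + s]addrC -fps_expD /fps_mul /B /fps_add.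
  under eq_bigr do rewrite mulrDl.
  rewrite big_split; congr (_ + _); rewrite big_ord_recl big1.
    by rewrite /fps_const /= mul1r subn0 addr0.
  by move=> i _; rewrite mul0r.
(* The triple product is bracketed in two ways: [AB] evaluates it here, while [BC] later expands it
   into the sum. *)
have H : n`!%:R * fps_mul A (fps_mul B (fps_exp y)) n = 2 * (y + s * x) ^+ n.
  rewrite fps_mulA.
  have -> : fps_mul (fps_mul A B) (fps_exp y) n
          = fps_mul (fps_const 2) (fps_exp (s * x + y)) n.
    transitivity (fps_mul (fps_mul (fps_const 2) (fps_exp (s * x))) (fps_exp y) n).
      by apply: eq_bigr => i _; rewrite AB.
    by rewrite -fps_mulA; apply: eq_bigr => i _; rewrite fps_expD.
  rewrite /fps_mul big_ord_recl big1 ?addr0 => [|i _]; last by rewrite mul0r.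
  rewrite /fps_const /fps_exp subn0 addrC.
  by field; rewrite natr_fact_neq0.
(* The Euler polynomial carries the index [n - k], whereas the product indexes [A] by the summation
   variable, hence the reversal. *)
rewrite -H mulr_sumr [RHS](reindex_inj rev_ord_inj) /=.
apply: eq_bigr => k _; have le_kn : (k <= n)%N by rewrite -ltnS.
rewrite subSS subKn // BC /A /fps_add /fps_exp -(bin_fact le_kn) !natrM.
by field; rewrite !natr_fact_neq0.
Qed.

End Char0.

Theorem corollary21 (F : fieldType) (charF : [pchar F] =i pred0)
    (L : fieldType) (iota : {rmorphism {fraction {mpoly F[3]}} -> L})
    (s : L) (n : nat) :
  let x := iota (ratvar F 0) in
  let y := iota (ratvar F 1) in
  let t := iota (ratvar F 2) in
  s ^+ 2 = y ^+ 2 + 4 * t ->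
  (0 < n)%N ->
  \sum_(k < n.+1)
     'C(n, k)%:R * s ^+ (n - k) * (2 ^+ k * lucas y t k + 2 * y ^+ k)
       * (euler_poly L (n - k)).[x]
  = 2 * (y + s * x) ^+ n + 2 * (y + (x - 1) * s) ^+ n.
Proof.
move=> x y t Hs _.
(* A ring morphism between fields preserves the characteristic, so [f] transports characteristic 0
   from [F] to [L]. *)
pose f : {rmorphism F -> L} :=
  iota \o (@tofrac {mpoly F[3]}) \o (@mpolyC 3 F).
have charL : [pchar L] =i pred0 by move=> p; rewrite (fmorph_pchar f).
have -> : y + (x - 1) * s = (y - s) + s * x by ring.
rewrite -!(euler_poly_binomial charL) -big_split; apply: eq_bigr => k _ /=.
by rewrite (lucas_binet _ Hs) subrK; ring.
Qed.
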